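(* Let $p>1$ and $q=\frac{p}{p-1}$. Let $I\subseteq\mathbb{R}$ be an interval with interior $I^\circ$, let $f:I^\circ\to\mathbb{R}$ be a twice differentiable function on $I^\circ$, and let $a,b\in I$ with $a<b$ and $f''\in L^1[a,b]$. If the mapping $|f''|^q$ is $(h-(\alpha,m))$-convex on $[a,b]$, then $$\left|\frac{f(a)+f(b)}{2}-\frac{1}{b-a}\int_a^b f(x)\,dx\right|\le \frac{(b-a)^2}{2}\,\beta^{1/p}(p+1,p+1)\left[\left\{|f''(a)|^q-m\left|f''\left(\frac bm\right)\right|^q\right\}\int_0^1h^\alpha(t)\,dt+m\left|f''\left(\frac bm\right)\right|^q\right]^{1/q}.$$
   Context: Notation: $h^\alpha(t)=(h(t))^\alpha$; $\beta(x,y)=\int_0^1t^{x-1}(1-t)^{y-1}\,dt$ for $x,y>0$ is Euler's Beta function and $\beta^{1/p}(x,y)=(\beta(x,y))^{1/p}$. Let $h:\mathcal{J}\subseteq\mathbb{R}\to\mathbb{R}$ be a non-negative function, $h\neq 0$, and let $(\alpha,m)\in[0,1]^2$. A function $g$ is $(h-(\alpha,m))$-convex on $D\subseteq\mathbb{R}$ if $g$ is non-negative and, for all $x,y\in D$ and $\lambda\in(0,1)$, $$g(\lambda x+m(1-\lambda)y)\le h^\alpha(\lambda)\,g(x)+m\,(1-h^\alpha(\lambda))\,g(y).$$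
   Formalization: Convexity of |f''|^q is assumed on [a,b] together with the point b/m, since with [a,b] alone the claim is false; also a, b and b/m lie in I°, m is nonzero and h^α is integrable on [0,1], so that all terms are defined. *)

(* Defs.v *)
(* MathComp-Analysis; [R : realType] plays the role of the real line. *)
From HB Require Import structures.
From mathcomp Require Import all_boot all_order all_algebra.
From mathcomp Require Import all_classical all_reals all_analysis.

Set Implicit Arguments.
Unset Strict Implicit.
Unset Printing Implicit Defensive.

Import Order.TTheory GRing.Theory Num.Theory.
Import numFieldNormedType.Exports.

Local Open Scope classical_set_scope.
Local Open Scope ring_scope.

(* The library's [beta_fun] takes natural-number arguments only.  For
   [0 < x] and [0 < y] the integrand is Lebesgue integrable on [0, 1]. *)
Definition Beta (R : realType) (x y : R) : R :=
  \int[lebesgue_measure]_(t in `[0, 1]) (t `^ (x - 1) * (1 - t) `^ (y - 1)).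

(* The functions are total, but the values of [h] off ]0, 1[ play no role; the
   values of [g] at the points [l * x + m * (1 - l) * y] do, and these points
   need not lie in [D] when [m < 1].  [powR] satisfies [0 `^ 0 = 1]. *)
Definition h_alpha_m_convex (R : realType) (h : R -> R) (alpha m : R)
    (D : set R) (g : R -> R) : Prop :=
  (forall x, D x -> 0 <= g x) /\
  (forall x y l, D x -> D y -> 0 < l < 1 ->
     g (l * x + m * (1 - l) * y) <=
     h l `^ alpha * g x + m * (1 - h l `^ alpha) * g y).

(* Main.v *)
Require Import Defs.
From HB Require Import structures.
From mathcomp Require Import all_boot all_order all_algebra.
From mathcomp Require Import all_classical all_reals all_analysis.
From mathcomp Require Import measurable_realfun ring lra.

(** The left-hand side is the trapezoid error, and for a smooth [f] two
    integrations by parts give, with [l t = t a + (1 - t) b],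
<<
    (f a + f b) / 2 - (b - a)^-1 \int_a^b f
      = (b - a)^2 / 2 \int_0^1 t (1 - t) f''(l t) dt.
>>
    Hoelder's inequality separates the weight from the second derivative: the
    p-norm of [t (1 - t)] is [Beta (p + 1) (p + 1) `^ p^-1]
    ([weighted_integral_le_Beta]), and the convexity of [|f''|^q] at the points
    [a] and [b / m], for which [t a + m (1 - t) (b / m) = l t], bounds
    [|f'' (l t)|^q] by [h^alpha(t) |f'' a|^q + m (1 - h^alpha(t)) |f''(b/m)|^q].
    Integrating in [t] gives the bracket ([integral_convex_bound]).

    The delicate point is the integral identity.  Here [f''] exists everywhere
    but is merely integrable, so [f'] is not continuously differentiable and
    the elementary fundamental theorem of calculus does not apply.  Only an
    inequality is needed, however: a function whose derivative exists everywhere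
    and is bounded above by a measurable [g >= 0] increases by at most the
    integral of [g] ([increment_le_integral]).  With
    [w] the weight [(x - a) (b - x) / 2], this is applied to [H] and [- H],
<<
    H x = w x k' x - w' x k x - \int_a^x k,
>>
    whose derivative is exactly [w k''] since [w'' = - 1], and whose increment
    over [[a, b]] is [b - a] times the trapezoid error of [k]
    ([trapezoid_error_le]); it is used for [k = f \o l] on [[0, 1]].

    The increment bound is the classical argument for everywhere
    differentiable functions: by the Vitali-Caratheodory construction
    ([vitali_caratheodory_approx]) there is [u] with an integral only slightly
    larger than that of [g] and which stays, in a neighbourhood of each point
    [x], above a constant larger than [g x].  Then the indefinite integral of
    [u] minus [F] increases through every point, hence increases
    ([locally_increasing_le]). *)

Set Implicit Arguments.
Unset Strict Implicit.
Unset Printing Implicit Defensive.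

Import Order.TTheory GRing.Theory Num.Theory.
Import numFieldNormedType.Exports.

Local Open Scope classical_set_scope.
Local Open Scope ring_scope.

Local Notation mu := lebesgue_measure.

(** * Functions with an integrable bound on the derivative *)

(** The supremum of the points [x] of [[c, d]] with [F c <= F x] is attained,
    by the hypothesis to the left of it, and equals [d], by the hypothesis to
    the right of it. *)
Lemma locally_increasing_le (R : realType) (F : R -> R) (c d : R) : c <= d ->
  (forall x, c <= x <= d -> \forall y \near x,
     (y <= x -> F y <= F x) /\ (x <= y -> F x <= F y)) ->
  F c <= F d.
Proof.
move=> cd locF.
pose S := [set x | c <= x <= d /\ F c <= F x].
have Sc : S c by split=> //; rewrite lexx.
have supS : has_sup S.
  by split; [exists c | exists d => x [/andP[]]].
set s := sup S.
have ubS x : S x -> x <= s by move=> Sx; apply: sup_upper_bound.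
have cs : c <= s by exact: ubS.
have sd : s <= d by apply: ge_sup; [exists c | move=> x [/andP[]]].
have /nbhs_ballP[e /= e0 He] := locF s ltac:(by rewrite cs).
have Fcs : F c <= F s.
  have [x Sx xs] := sup_adherent e0 supS.
  apply: le_trans Sx.2 _.
  have xs' : x <= s by exact: ubS.
  apply: (He x _).1 => //.
  by rewrite /ball/= ger0_norm ?subr_ge0// ltrBlDr -ltrBlDl.
have [sdE|sdN] := eqVneq s d; first by rewrite -sdE.
have sd' : s < d by rewrite lt_neqAle sdN.
pose y := Num.min (s + e / 2) d.
have sy : s < y by rewrite lt_min sd' andbT ltrDl divr_gt0.
suff Sy : S y by move: (ubS y Sy); rewrite leNgt sy.
split; first by rewrite (le_trans cs (ltW sy)) ge_min lexx orbT.
apply: le_trans Fcs _; apply: (He y _).2; last exact: ltW.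
rewrite /ball/= ltr0_norm ?subr_lt0// opprB.
have : y <= s + e / 2 by rewrite ge_min lexx.
by move: e0; lra.
Qed.


(** [D] is cut into the level sets [E k] on which [k s <= g < (k + 1) s], each
    [E k] is covered by an open [U k] of nearly the same measure, and [u] is the
    sum of the [(k + 1) s] times the indicators of the [U k].  Openness of [U k]
    is what makes the bound [g x < c <= u y] persist for [y] near [x]. *)
Lemma vitali_caratheodory_approx (R : realType) (D : set R) (g : R -> R)
    (e : R) :
  measurable D -> (lebesgue_measure D < +oo)%E ->
  measurable_fun D g -> (forall x, D x -> 0 <= g x) -> 0 < e ->
  exists u : R -> \bar R, [/\ measurable_fun [set: R] u, forall x, (0 <= u x)%E,
    forall x, D x -> exists2 c, g x < c & \forall y \near x, (c%:E <= u y)%E &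
    (\int[lebesgue_measure]_(x in D) u x <=
     \int[lebesgue_measure]_(x in D) (g x)%:E + e%:E)%E].
Proof.
move=> mD Doo mg g0 e0.
have Dfin : mu D \is a fin_num by rewrite ge0_fin_numE.
pose M := fine (mu D).
have M0 : 0 <= M by rewrite fine_ge0.
(* the step [s] costs [s * mu D <= e / 2]; the [M + 1] covers [mu D = 0] *)
pose s := e / 2 / (M + 1).
have s0 : 0 < s by rewrite !divr_gt0// ltr_wpDl.
pose E k := D `&` [set x | k%:R * s <= g x < k.+1%:R * s].
pose c k : R := k.+1%:R * s.
have c0 k : 0 < c k by rewrite mulr_gt0.
have mE k : measurable (E k).
  rewrite /E (_ : [set x | _] = g @^-1` `[k%:R * s, k.+1%:R * s[); last first.
    by apply/seteqP; split => x /=; rewrite in_itv.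
  exact: mg.
have DE : D = \bigcup_k E k.
  apply/seteqP; split => [x Dx|x [k _ []//]].
  exists (Num.trunc (g x / s)) => //; split=> //=.
  rewrite -ler_pdivlMr// -ltr_pdivrMr//.
  by apply: truncn_itv; rewrite divr_ge0 ?g0// ltW.
have tE : trivIset setT E.
  apply/trivIsetP => i j _ _ ij; apply/seteqP; split => // x /= [[Dx +] [_ +]].
  rewrite /= -!(ler_pdivlMr _ _ s0) -!(ltr_pdivrMr _ _ s0).
  move=> /truncn_def Hi /truncn_def Hj.
  by move: ij; rewrite -Hi Hj eqxx.
have Efin k : (mu (E k) < +oo)%E.
  apply: le_lt_trans Doo.
  apply: le_measure; [by apply/mem_set; exact: mE|exact/mem_set|].
  by move=> x [].
(* the excess of [U k] over [E k], weighted by [c k], sums to [e / 2] *)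
have dk0 k : 0 < e / 2 / (2 ^ k.+1)%:R / c k.
  by rewrite !divr_gt0// ltr0n expn_gt0.
have [U HU] :=
  choice (fun k => lebesgue_regularity_outer (mE k) (Efin k) (dk0 k)).
have mU k : measurable (U k).
  by have [oU _ _] := HU k; exact: open_measurable.
pose v k x : \bar R := ((c k)%:E * (\1_(U k) x)%:E)%E.
have v0 k x : (0 <= v k x)%E.
  by rewrite mule_ge0// lee_fin// ltW.
have mv k : measurable_fun [set: R] (v k).
  apply: measurable_funeM; apply/measurable_EFinP; exact: measurable_indic.
exists (fun x => \sum_(k <oo) v k x)%E; split.
- exact: ge0_emeasurable_sum.
- by move=> x; apply: nneseries_ge0.
- move=> x Dx; move: (Dx); rewrite {1}DE => -[k _ [_ /= /andP[kg gk]]].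
  exists (c k) => //.
  have [oU EU _] := HU k.
  have Ux : U k x by apply: EU; split=> //=; rewrite kg.
  have := open_nbhs_nbhs (conj oU Ux).
  apply: filterS => y Uy.
  apply: le_trans (nneseries_lim_ge k.+1 _); last by move=> *; exact: v0.
  rewrite big_nat_recr//= {2}/v indicE mem_set// mule1.
  by rewrite leeDr //; apply: sume_ge0 => *; exact: v0.
rewrite integral_nneseries//; last first.
  by move=> k; apply: measurable_funTS; exact: mv.
have mgE k : measurable_fun (E k) (fun x => (g x + s)%:E).
  apply/measurable_EFinP; apply: measurable_funD => //.
  by apply: measurable_funS mg => // x [].
have vE k : (\int[mu]_(x in D) v k x <=
    \int[mu]_(x in E k) (g x + s)%:E + (e / 2 / (2 ^ k.+1)%:R)%:E)%E.
  rewrite ge0_integralZl//; first last.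
  - by rewrite lee_fin ltW.
  - by apply/measurable_EFinP; apply: measurable_indic; exact: mU.
  rewrite integral_indic//; last exact: mU.
  rewrite (setIC (U k)).
  have [_ EU /ltW Hk] := HU k.
  have ckge0 : (0 <= (c k)%:E)%E by rewrite lee_fin ltW.
  have mUE : measurable (U k `\` E k).
    by apply: measurableD; [exact: mU|exact: mE].
  apply: (@le_trans _ _ ((c k)%:E * (mu (E k) + mu (U k `\` E k)))%E).
    apply: lee_wpmul2l => //.
    rewrite -measureU ?setDIK//; last exact: mE.
    rewrite setDUK//.
    apply: le_measure; [|by apply/mem_set; exact: mU|by move=> x []].
    by apply/mem_set/measurableI => //; exact: mU.
  rewrite ge0_muleDr//; apply: leeD.
    rewrite -integral_cst; last exact: mE.
    apply: ge0_le_integral => //; first exact: mE.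
    + exact: mgE.
    + move=> x [_ /= /andP[kg _]]; rewrite lee_fin /c -natr1 mulrDl mul1r.
      by rewrite lerD2r.
  apply: le_trans (lee_wpmul2l _ Hk) _ => //.
  by rewrite -EFinM mulrC divfK// gt_eqF.
have gs0 x : D x -> 0 <= g x + s by move=> Dx; rewrite addr_ge0 ?g0// ltW.
apply: le_trans (lee_nneseries _ (fun k _ => vE k)) _.
  by move=> k _ _; apply: integral_ge0 => x _; exact: v0.
apply: le_trans (epsilon_trick _ _ _) _.
- by move=> k; apply: integral_ge0 => x [Dx _]; rewrite lee_fin gs0.
- by rewrite divr_ge0// ltW.
rewrite -ge0_integral_bigcup//; last 2 first.
- rewrite -DE; apply/measurable_EFinP; exact: measurable_funD.
- by rewrite -DE => x Dx; rewrite lee_fin gs0.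
rewrite -DE.
under eq_integral do rewrite EFinD.
rewrite ge0_integralD//; last 2 first.
- exact/measurable_EFinP.
- by move=> x Dx; rewrite lee_fin ltW.
have -> : (\int[mu]_(x in D) s%:E = (s * M)%:E)%E.
  by rewrite [RHS]EFinM fineK//; exact: integral_cst.
rewrite -addeA leeD2l// -EFinD lee_fin [leRHS]splitr lerD2r /s -mulrA ler_piMr//.
  by rewrite divr_ge0// ltW.
by rewrite mulrC ler_pdivrMr ?mul1r ?lerDl// ltr_wpDl.
Qed.

(** For [u] as in [vitali_caratheodory_approx], the function
    [U x = \int_a^x u] satisfies [U z - U y >= k (z - y)] near each [x], for
    some [k > F' x], so that [U - F] is locally increasing at every point of
    the open interval; the endpoints are reached by continuity of [F]. *)
Lemma increment_le_integral (R : realType) (F g : R -> R) (a b : R) : a < b ->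
  {within `[a, b], continuous F} ->
  {in `]a, b[, forall x : R, derivable F x 1 /\ derive1 F x <= g x} ->
  measurable_fun `[a, b] g -> {in `[a, b], forall x, 0 <= g x} ->
  ((F b - F a)%:E <= \int[mu]_(x in `[a, b]) (g x)%:E)%E.
Proof.
move=> ab cF dF mg g0.
apply/lee_addgt0Pr => e e0.
have Doo : (mu `[a, b] < +oo)%E.
  by rewrite lebesgue_measure_itv/= lte_fin ab -EFinB ltry.
have g0' x : `[a, b]%classic x -> 0 <= g x by exact: g0.
have mD : measurable `[a, b]%classic by exact: measurable_itv.
have [u [mu_ u0 gu intu]] := vitali_caratheodory_approx mD Doo mg g0' e0.
apply: le_trans intu.
have [->|uoo] := eqVneq (\int[mu]_(x in `[a, b]) u x)%E +oo%E.
  by rewrite leey.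
pose U x := fine (\int[mu]_(t in `[a, x]) u t).
have Ufin x : x <= b -> (\int[mu]_(t in `[a, x]) u t)%E = (U x)%:E.
  move=> xb; rewrite fineK// ge0_fin_numE; last by apply: integral_ge0.
  apply: le_lt_trans (_ : \int[mu]_(t in `[a, b]) u t < +oo)%E.
    apply: ge0_subset_integral => //; first exact: measurable_funTS.
    by apply: subset_itvl; rewrite bnd_simp.
  by rewrite ltey.
have Uinc k y z : 0 <= k -> a <= y -> y <= z -> z <= b ->
    (forall t, y <= t <= z -> (k%:E <= u t)%E) -> k * (z - y) <= U z - U y.
  move=> k0 ay yz zb ku.
  rewrite lerBrDr -lee_fin EFinD -!Ufin ?(le_trans yz)// addeC.
  have -> : `[a, z]%classic = `[a, y] `|` `]y, z].
    by rewrite -itv_bndbnd_setU// bnd_simp.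
  rewrite ge0_integral_setU//=; [|exact: measurable_funTS|].
    rewrite leeD2l//.
    have -> : (k * (z - y))%:E = (\int[mu]_(t in `]y, z]) cst k%:E t)%E.
      transitivity (k%:E * mu `]y, z])%E; last first.
        by apply/esym; exact: integral_cst.
      rewrite lebesgue_measure_itv/= lte_fin.
      case: ltP => [_|zy]; first by rewrite -EFinB -EFinM.
      by rewrite (_ : z = y) ?subrr ?mulr0 ?mule0//; apply/le_anti/andP.
    apply: ge0_le_integral => //.
    - exact: measurable_funTS.
    - move=> t /=; rewrite in_itv/= => /andP[yt tz]; apply: ku.
      by rewrite ltW.
  apply/disj_setPS => t [] /=; rewrite !in_itv/= => /andP[_ ty] /andP[yt _].
  by move: yt; rewrite ltNge ty.
have UF c d : a < c -> c <= d -> d < b -> U c - F c <= U d - F d.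
  move=> ac cd db; apply: (@locally_increasing_le _ (fun x => U x - F x)) => //.
  move=> x /andP[cx xd].
  have ax : a < x by exact: lt_le_trans cx.
  have xb : x < b by exact: le_lt_trans db.
  have xab : x \in `]a, b[ by rewrite in_itv/= ax.
  have [dFx F'x] := dF _ xab.
  have /gu[k gk ku] : `[a, b]%classic x by rewrite /= in_itv/= !ltW.
  have k0 : 0 <= k by rewrite (le_trans _ (ltW gk))// g0// in_itv/= !ltW.
  have F'k : derive1 F x < k by exact: le_lt_trans gk.
  have slope : \forall y \near x, y != x -> (F y - F x) / (y - x) < k.
    move: dFx => /cvg_ex[/= l Fl].
    have lk : l < k.
      by move: F'k; rewrite derive1E /derive; move/cvg_lim : (Fl) => ->.
    have [r /= r0 Hr] := cvgr_lt _ Fl _ lk.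
    exists r => // y xy yx.
    have := Hr (y - x); rewrite /= sub0r opprB subr_eq0 => /(_ xy yx).
    by rewrite scaler1 subrK mulrC.
  have /nbhs_ballP[r /= r0 Hr] : \forall y \near x,
      [/\ a < y, y < b, (k%:E <= u y)%E & y != x -> (F y - F x) / (y - x) < k].
    near=> y; split; near: y => //.
    - exact: lt_nbhsr.
    - exact: lt_nbhsl.
  have between s t v : ball x r s -> ball x r t -> s <= v <= t -> ball x r v.
    rewrite /ball/= !ltr_distlC => /andP[xs _] /andP[_ tx] /andP[sv vt].
    by rewrite (lt_le_trans xs)// (le_lt_trans vt).
  have xr : ball x r x by exact: ballxx.
  exists r => // y xy; have [ay yb _ Fy] := Hr _ xy.
  split => [yx|xy'].
    have [->//|yNx] := eqVneq y x.
    have yx' : y < x by rewrite lt_neqAle yNx.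
    have Uk : k * (x - y) <= U x - U y.
      apply: Uinc => //; [exact: ltW|exact: ltW|] => t /(between _ _ _ xy xr) tr.
      by have [] := Hr _ tr.
    have : F x - F y <= k * (x - y).
      by have := ltW (Fy yNx); rewrite ler_ndivrMr ?subr_lt0//; lra.
    by move: Uk; lra.
  have [<-//|xNy] := eqVneq x y.
  have xy'' : x < y by rewrite lt_neqAle xNy.
  have Uk : k * (y - x) <= U y - U x.
    apply: Uinc => //; [exact: ltW|exact: ltW|] => t /(between _ _ _ xr xy) tr.
    by have [] := Hr _ tr.
  have : F y - F x <= k * (y - x).
    by have := ltW (Fy ltac:(by rewrite eq_sym)); rewrite ler_pdivrMr ?subr_gt0.
  by move: Uk; lra.
have FU c d : a < c -> c <= d -> d < b -> F d <= U b + F c.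
  move=> ac cd db.
  have ad : a < d := lt_le_trans ac cd.
  have Uc0 : 0 <= U c by rewrite fine_ge0// integral_ge0.
  have Udb : U d <= U b.
    rewrite -lee_fin -!Ufin ?(ltW db)//; apply: ge0_subset_integral => //.
      exact: measurable_funTS.
    by apply: subset_itvl; rewrite bnd_simp ltW.
  by have := UF c d ac cd db; move: Uc0 Udb; lra.
have /(continuous_within_itvP _ ab)[_ cFa cFb] := cF.
have Fb c : a < c -> c < b -> F b <= U b + F c.
  move=> ac cb; apply: (cvgr_to_le cFb); near=> d; apply: FU => //.
  by near: d; exact: nbhs_left_ge.
suff : F b - U b <= F a by rewrite Ufin// lee_fin; lra.
apply: (cvgr_to_ge cFa); near=> c.
rewrite lerBlDl; apply: Fb => //.
Unshelve. all: by end_near.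
Qed.

(** * Calculus along the segment *)

Lemma is_derive_continuous (R : realType) (f : R -> R) (x df : R) :
  is_derive x 1 f df -> {for x, continuous f}.
Proof. by move=> [dfx _]; apply/differentiable_continuous/derivable1_diffP. Qed.

Lemma is_derive_segment (R : realType) (a b t : R) :
  is_derive t 1 (fun s : R => s * a + (1 - s) * b) (a - b).
Proof.
have -> : (fun s : R => s * a + (1 - s) * b) = (a - b) *: id + cst b.
  apply/funext => s; transitivity ((a - b) * s + b); last by [].
  by ring.
by apply: is_derive_eq; rewrite addr0 scaler1.
Qed.

Lemma interior_is_interval (R : realType) (I : set R) :
  is_interval I -> is_interval I°.
Proof.
move=> hI a b Ia Ib x /andP[ax xb].
have [<-//|aNx] := eqVneq a x; have [->//|xNb] := eqVneq x b.
have ax' : a < x by rewrite lt_neqAle aNx.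
have xb' : x < b by rewrite lt_neqAle xNb.
have : \forall y \near x, a < y < b.
  near=> y; apply/andP; split; near: y; [exact: lt_nbhsr|exact: lt_nbhsl].
apply: filterS => y /andP[ay yb].
by apply: (hI a b); [exact: interior_subset|exact: interior_subset|rewrite !ltW].
Unshelve. all: by end_near.
Qed.

Lemma Rintegral_segment_param (R : realType) (f : R -> R) (a b : R) : a < b ->
  {in `[a, b], continuous f} ->
  \int[mu]_(x in `[a, b]) f x =
  (b - a) * \int[mu]_(t in `[0, 1]) f (t * a + (1 - t) * b).
Proof.
move=> ab cf.
pose l : R -> R := fun t => t * a + (1 - t) * b.
have l0 : l 0 = b by rewrite /l; ring.
have l1 : l 1 = a by rewrite /l; ring.
have dl (t : R) : is_derive t 1 l (a - b) by exact: is_derive_segment.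
have l'E : derive1 l = cst (a - b).
  by apply/funext => t; have [_ lt'] := dl t; rewrite derive1E.
have cl : continuous l.
  by move=> t; exact: is_derive_continuous (dl t).
have ckl : {within `[0, 1], continuous (f \o l)}.
  apply: continuous_in_subspaceT => t /set_mem /=; rewrite in_itv/= => /andP[t0 t1].
  apply: continuous_comp; first exact: cl.
  by apply: cf; rewrite in_itv/= /l; apply/andP; split; nra.
have cf' : {within `[a, b], continuous f}.
  by apply: continuous_in_subspaceT => x /set_mem; exact: cf.
have := @integration_by_substitution_decreasing _ l f 0 1 ler01.
rewrite l0 l1 l'E => H.
rewrite /Rintegral H //; first last.
- split; first by move=> t _; have [] := dl t.
  + by apply: cvg_at_right_filter; exact: cl.
  + by apply: cvg_at_left_filter; exact: cl.
- exact: is_cvg_cst.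
- exact: is_cvg_cst.
- by move=> t _; exact: cvg_cst.
- by move=> s t _ _ st; rewrite /l; nra.
rewrite -RintegralZl//; last first.
  by apply: continuous_compact_integrable => //; exact: segment_compact.
apply: eq_Rintegral => t _.
by transitivity (f (l t) * - (a - b)); [|rewrite opprB mulrC].
Qed.

(** * The trapezoid error *)

(** The primitive [H] of [w k2] is written down explicitly, so that the
    second derivative [k2] is never integrated as a derivative; it enters only
    through the bound [H' <= w |k2|]. *)
Lemma trapezoid_error_le (R : realType) (k k1 k2 : R -> R) (a b : R) : a < b ->
  {in `[a, b], forall x : R, is_derive x 1 k (k1 x)} ->
  {in `[a, b], forall x : R, is_derive x 1 k1 (k2 x)} ->
  measurable_fun `[a, b] k2 ->
  (`|(b - a) * ((k a + k b) / 2) - \int[mu]_(x in `[a, b]) k x|%:E <=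
   \int[mu]_(x in `[a, b]) ((x - a) * (b - x) / 2 * `|k2 x|)%:E)%E.
Proof.
move=> ab dk dk1 mk2.
have cvgk x : x \in `[a, b] -> {for x, continuous k}.
  by move=> /dk dkx; exact: is_derive_continuous dkx.
have cvgk1 x : x \in `[a, b] -> {for x, continuous k1}.
  by move=> /dk1 dkx; exact: is_derive_continuous dkx.
have ck : {within `[a, b], continuous k}.
  by apply: continuous_in_subspaceT => x /set_mem; exact: cvgk.
have ik : mu.-integrable `[a, b] (EFin \o k).
  by apply: continuous_compact_integrable => //; exact: segment_compact.
pose P x := \int[mu]_(t in `[a, x]) k t.
have cP : {within `[a, b], continuous P}.
  exact: parameterized_integral_continuous (ltW ab) ik.
have dP x : x \in `]a, b[ -> is_derive x 1 P (k x).
  rewrite in_itv/= => /andP[ax xb].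
  have [|dPx P'x] := continuous_FTC1_closed xb ik ax.
    by apply: cvgk; rewrite in_itv/= !ltW.
  by apply: DeriveDef; [exact: dPx|rewrite -derive1E].
pose w : R -> R := fun x => (x - a) * (b - x) / 2.
pose w1 : R -> R := fun x => (a + b) / 2 - x.
have dw (x : R) : is_derive x 1 w (w1 x).
  have -> : w = 2^-1 *: ((id - cst a) * (cst b - id)).
    by apply/funext => y; rewrite /w mulrC.
  apply: is_derive_eq.
  transitivity (2^-1 * ((x - a) * (0 - 1) + (b - x) * (1 - 0))); first by [].
  by rewrite /w1; field.
have dw1 (x : R) : is_derive x 1 w1 (- 1).
  have -> : w1 = cst ((a + b) / 2) - id by [].
  by apply: is_derive_eq; rewrite sub0r.
have w0 x : x \in `[a, b] -> 0 <= w x.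
  by rewrite in_itv/= => /andP[ax xb]; rewrite divr_ge0// mulr_ge0// subr_ge0.
pose H : R -> R := w * k1 - w1 * k - P.
have dH (x : R) : x \in `]a, b[ -> is_derive x 1 H (w x * k2 x).
  move=> xab; have xab' : x \in `[a, b] by exact: subset_itv_oo_cc.
  have dkx := dk _ xab'; have dk1x := dk1 _ xab'; have dPx := dP _ xab.
  apply: is_derive_eq.
  transitivity ((w x * k2 x + k1 x * w1 x) - (w1 x * k1 x + k x * - 1) - k x).
    by [].
  by ring.
have cw x : {for x, continuous w}.
  exact: is_derive_continuous (dw x).
have cw1 x : {for x, continuous w1}.
  exact: is_derive_continuous (dw1 x).
have cH : {within `[a, b], continuous H}.
  have cwk : {within `[a, b], continuous (w * k1 - w1 * k)}.
    apply: continuous_in_subspaceT => x /set_mem xab.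
    apply: continuousB; apply: continuousM => //.
    - exact: cvgk1.
    - exact: cvgk.
  by move=> x; apply: continuousB; [exact: cwk|exact: cP].
have HE : H b - H a = (b - a) * ((k a + k b) / 2) - \int[mu]_(x in `[a, b]) k x.
  have -> : H a = - ((b - a) / 2 * k a).
    transitivity (w a * k1 a - w1 a * k a - P a); first by [].
    by rewrite /P set_itv1 Rintegral_set1 /w /w1; field.
  transitivity (w b * k1 b - w1 b * k b - P b + (b - a) / 2 * k a).
    by rewrite opprK.
  by rewrite /P /w /w1; field.
have g0 : {in `[a, b], forall x, 0 <= w x * `|k2 x|}.
  by move=> x /w0 wx; rewrite mulr_ge0.
have mg : measurable_fun `[a, b] (fun x => w x * `|k2 x|).
  apply: measurable_funM; last exact: measurableT_comp.
  by apply: measurable_funTS; apply: continuous_measurable_fun.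
rewrite -HE; have [_|_] := ger0P (H b - H a).
  apply: (@increment_le_integral _ H (fun x => w x * `|k2 x|) a b ab cH _ mg g0).
  move=> x xab; have [dHx H'x] := dH _ xab; split; first exact: dHx.
  rewrite derive1E H'x; apply: ler_wpM2l; last exact: ler_norm.
  by apply: w0; exact: subset_itv_oo_cc.
have -> : - (H b - H a) = (- H) b - (- H) a.
  by transitivity (- H b - - H a); [rewrite opprB opprK addrC|].
apply: (@increment_le_integral _ (- H) (fun x => w x * `|k2 x|) a b ab _ _ mg g0).
  by move=> x; apply: continuousN; exact: cH.
move=> x xab; have [dHx H'x] := dH _ xab; split; first exact: derivableN.
rewrite derive1E deriveN// H'x -mulrN; apply: ler_wpM2l.
  by apply: w0; exact: subset_itv_oo_cc.
by rewrite ler_normr lexx orbT.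
Qed.

(** * Hoelder's inequality with the weight t (1 - t) *)

(** The functions are extended by zero outside [D]; since [p] and [q] are
    positive, this changes no integral, and the inequality on the whole space
    applies. *)
Lemma hoelder_integral (d : measure_display) (T : measurableType d)
    (R : realType) (nu : {measure set T -> \bar R}) (D : set T) (f g : T -> R)
    (p q : R) :
  measurable D -> measurable_fun D f -> measurable_fun D g ->
  0 < p -> 0 < q -> p^-1 + q^-1 = 1 ->
  (\int[nu]_(x in D) `|f x * g x|%:E <=
   (\int[nu]_(x in D) (`|f x| `^ p)%:E) `^ p^-1 *
   (\int[nu]_(x in D) (`|g x| `^ q)%:E) `^ q^-1)%E.
Proof.
move=> mD mf mg p0 q0 pq.
have normE (u : T -> R) r : 0 < r ->
    (\int[nu]_(x in D) (`|u x| `^ r)%:E = \int[nu]_x (`|(u \_ D) x| `^ r)%:E)%E.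
  move=> r0; rewrite integral_mkcond; apply: eq_integral => x _.
  by rewrite !patchE; case: ifPn => // _; rewrite normr0 powR0// gt_eqF.
have := @hoelder _ _ _ nu (f \_ D) (g \_ D) p q.
rewrite Lnorm1 unlock => /(_ _ _ p0 q0 pq) H.
rewrite !normE// integral_mkcond.
under eq_integral => x _.
  rewrite (_ : _ x = `|(f \_ D) x * (g \_ D) x|%:E); first over.
  by rewrite !patchE; case: ifPn => // _; rewrite mulr0 normr0.
by apply: H; apply/(measurable_restrictT _ mD).
Qed.

Lemma weighted_integral_le_Beta (R : realType) (p q B : R) (y : R -> R) :
  1 < p -> q = p / (p - 1) -> measurable_fun `[0 : R, 1] y ->
  (\int[mu]_(t in `[0%R, 1%R]) (`|y t| `^ q)%:E <= B%:E)%E ->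
  (\int[mu]_(t in `[0%R, 1%R]) (t * (1 - t) * `|y t|)%:E <=
   (Beta (p + 1) (p + 1) `^ p^-1 * B `^ q^-1)%:E)%E.
Proof.
move=> p1 qE my yB.
have p0 : 0 < p by apply: lt_trans p1.
have q0 : 0 < q by rewrite qE divr_gt0// subr_gt0.
have pq : p^-1 + q^-1 = 1 by rewrite qE; field; rewrite !gt_eqF// subr_gt0.
have mw : measurable_fun `[0 : R, 1] (fun t : R => t * (1 - t)).
  by apply: measurable_funM => //; exact: measurable_funB.
have := hoelder_integral mu (measurable_itv `[0 : R, 1]) mw my p0 q0 pq.
have w0 (t : R) : t \in `[0, 1]%classic -> 0 <= t * (1 - t).
  by rewrite inE/= in_itv/= => /andP[t0 t1]; rewrite mulr_ge0// subr_ge0.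
under eq_integral => t /w0 tw do rewrite normrM (ger0_norm tw).
move=> /le_trans; apply.
(* [fine], hidden in [Beta], is harmless: the integrand lies in [[0, 1]] *)
have BetaE : (\int[mu]_(t in `[0%R, 1%R]) (`|t * (1 - t)| `^ p)%:E)%E =
    (Beta (p + 1) (p + 1))%:E.
  rewrite /Beta /Rintegral fineK; last first.
    rewrite ge0_fin_numE; last first.
      by apply: integral_ge0 => t _; rewrite lee_fin mulr_ge0// powR_ge0.
    apply: (@le_lt_trans _ _ (\int[mu]_(t in `[0%R, 1%R]) cst 1 t)%E); last first.
      apply: (@le_lt_trans _ _ (1%E * mu `[0%R, 1%R])%E).
        by rewrite integral_cst.
      by rewrite lebesgue_measure_itv/= lte_fin ltr01 mul1e oppr0 adde0 ltry.
    apply: ge0_le_integral => //.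
    - by move=> t _; rewrite lee_fin mulr_ge0// powR_ge0.
    - apply/measurable_EFinP; apply: measurable_funTS; apply: measurable_funM.
        exact: measurable_powR.
      apply: (measurableT_comp (measurable_powR _)).
      exact: measurable_funB.
    - move=> t; rewrite /= in_itv/= => /andP[t0 t1]; rewrite lee_fin addrK.
      have pow_le1 (s : R) : 0 <= s -> s <= 1 -> s `^ p <= 1.
        move=> s0 s1; have <- : (1 : R) `^ p = 1 by rewrite powR1.
        by apply: ge0_ler_powR; rewrite ?nnegrE// ltW.
      by rewrite mulr_ile1 ?powR_ge0 ?pow_le1 ?subr_ge0// gerBl.
  apply: eq_integral => t tI; rewrite ger0_norm ?w0//.
  move: tI; rewrite inE/= in_itv/= => /andP[t0 t1].
  by rewrite powRM ?subr_ge0// addrK.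
rewrite EFinM BetaE poweR_EFin lee_wpmul2l ?lee_fin ?powR_ge0// -poweR_EFin.
have y0 : (0 <= \int[mu]_(t in `[0%R, 1%R]) (`|y t| `^ q)%:E)%E.
  by apply: integral_ge0 => t _; rewrite lee_fin powR_ge0.
apply: gt0_ler_poweR => //; first by rewrite invr_ge0 ltW.
- by rewrite in_itv/= y0 leey.
- by rewrite in_itv/= (le_trans y0 yB) leey.
Qed.

(** * The convexity bound and the inequality *)

(** The pointwise bound may fail at [t = 0] and [t = 1], where convexity says
    nothing; these points are negligible. *)
Lemma integral_convex_bound (R : realType) (phi H : R -> R) (m A C : R) :
  measurable_fun `[0 : R, 1] phi -> (forall t, 0 <= phi t) ->
  mu.-integrable `[0, 1] (EFin \o H) ->
  (forall t, 0 < t < 1 -> phi t <= H t * A + m * (1 - H t) * C) ->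
  (\int[mu]_(t in `[0%R, 1%R]) (phi t)%:E <=
   ((A - m * C) * \int[mu]_(t in `[0%R, 1%R]) H t + m * C)%:E)%E.
Proof.
move=> mphi phi0 iH phiH.
have mH : measurable_fun `[0 : R, 1] H.
  by apply/measurable_EFinP; exact: measurable_int iH.
pose u t := (A - m * C) * H t + m * C.
have mu_ : measurable_fun `[0 : R, 1] u.
  by apply: measurable_funD => //; apply: measurable_funM.
have oo_cc : `]0 : R, 1[ `<=` `[0, 1] by exact: subset_itv_oo_cc.
have -> : ((A - m * C) * \int[mu]_(t in `[0%R, 1%R]) H t + m * C)%:E =
    (\int[mu]_(t in `[0%R, 1%R]) (u t)%:E)%E.
  have iAH : mu.-integrable `[0, 1] (EFin \o (fun t => (A - m * C) * H t)).
    have : mu.-integrable `[0, 1] (fun t => ((A - m * C)%:E * (EFin \o H) t)%E).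
      exact: integrableZl.
    by apply: eq_integrable => // t _; rewrite /= EFinM.
  have iC : mu.-integrable `[0, 1] (EFin \o (fun _ : R => m * C)).
    apply: continuous_compact_integrable; first exact: segment_compact.
    by apply: continuous_subspaceT => t; exact: cvg_cst.
  rewrite EFinD EFinM fineK; last exact: integrable_fin_num.
  under [RHS]eq_integral do rewrite /u EFinD.
  apply/esym/(etrans (integralD_EFin _ iAH iC)) => //; congr (_ + _)%E.
    under eq_integral do rewrite /= EFinM.
    exact: integralZl.
  transitivity ((m * C)%:E * mu `[0%R, 1%R])%E; first exact: integral_cst.
  by rewrite lebesgue_measure_itv/= lte_fin ltr01 oppr0 adde0 mule1.
have mphi' : measurable_fun `]0 : R, 1[ (EFin \o phi).
  by apply/measurable_EFinP; exact: measurable_funS oo_cc mphi.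
have mu' : measurable_fun `]0 : R, 1[ (EFin \o u).
  by apply/measurable_EFinP; exact: measurable_funS oo_cc mu_.
rewrite (integral_itv_bndoo true false mphi') (integral_itv_bndoo true false mu').
apply: ge0_le_integral => //; first by move=> t _; rewrite lee_fin.
move=> t; rewrite /= in_itv/= lee_fin => /phiH /le_trans; apply.
by rewrite /u; lra.
Qed.

Theorem theorem5 (R : realType) (p q : R) (hp : 1 < p) (hq : q = p / (p - 1))
  (J : set R) (h : R -> R)
  (J01 : `]0, 1[ `<=` J)
  (h_ge0 : forall t, J t -> 0 <= h t)
  (h_neq0 : exists2 t, J t & h t != 0)
  (alpha m : R) (halpha : 0 <= alpha <= 1) (hm : 0 <= m <= 1) (m_neq0 : m != 0)
  (h_int : lebesgue_measure.-integrable `[0, 1]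
             (fun t : R => (h t `^ alpha)%:E))
  (I : set R) (hI : is_interval I)
  (f : R -> R)
  (f_diff1 : forall x : R, I° x -> derivable f x 1)
  (f_diff2 : forall x : R, I° x -> derivable (derive1 f) x 1)
  (a b : R) (ha : I° a) (hb : I° b) (hbm : I° (b / m)) (hab : a < b)
  (f2_L1 : lebesgue_measure.-integrable `[a, b] (EFin \o derive1n 2 f))
  (f2_convex : h_alpha_m_convex h alpha m (`[a, b] `|` [set b / m])
                 (fun x : R => `|derive1n 2 f x| `^ q)) :
  `| (f a + f b) / 2
     - (b - a)^-1 * \int[lebesgue_measure]_(x in `[a, b]) f x |
  <= (b - a) ^+ 2 / 2 * Beta (p + 1) (p + 1) `^ p^-1
     * ((`|derive1n 2 f a| `^ q - m * `|derive1n 2 f (b / m)| `^ q)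
          * \int[lebesgue_measure]_(t in `[0, 1]) (h t `^ alpha)
        + m * `|derive1n 2 f (b / m)| `^ q) `^ q^-1.
Proof.
set f1 := derive1 f; set f2 := derive1n 2 f in f2_L1 f2_convex *.
have f2E : f2 = derive1 f1 by [].
have q0 : 0 < q by rewrite hq divr_gt0 ?subr_gt0// (lt_trans _ hp).
have ba0 : 0 < b - a by rewrite subr_gt0.
have abI x : a <= x <= b -> I° x by apply: interior_is_interval.
have df x : I° x -> is_derive x 1 f (f1 x).
  by move=> Ix; apply: DeriveDef; [exact: f_diff1|rewrite /f1 derive1E].
have df1 x : I° x -> is_derive x 1 f1 (f2 x).
  by move=> Ix; apply: DeriveDef; [exact: f_diff2|rewrite f2E derive1E].
have cf : {in `[a, b], continuous f}.
  by move=> x /abI /df dfx; exact: is_derive_continuous dfx.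
pose l : R -> R := fun t => t * a + (1 - t) * b.
have lab t : t \in `[0, 1] -> a <= l t <= b.
  by rewrite in_itv/= /l => /andP[t0 t1]; apply/andP; split; nra.
have dl (t : R) : is_derive t 1 l (a - b) by exact: is_derive_segment.
have cl : continuous l.
  by move=> t; exact: is_derive_continuous (dl t).
have mf2 : measurable_fun `[a, b] f2.
  by apply/measurable_EFinP; exact: measurable_int f2_L1.
have my : measurable_fun `[0 : R, 1] (f2 \o l).
  apply: (measurable_comp (F := `[a, b]%classic)) => //.
  - by move=> _ [t tI <-]; rewrite /= in_itv/=; exact: lab.
  - by apply: measurable_funTS; exact: continuous_measurable_fun.
pose A := `|f2 a| `^ q; pose C := `|f2 (b / m)| `^ q.
pose B := (A - m * C) * \int[mu]_(t in `[0, 1]) (h t `^ alpha) + m * C.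
rewrite -[X in _ <= _ * X `^ _]/B.
have yB : (\int[mu]_(t in `[0%R, 1%R]) (`|(f2 \o l) t| `^ q)%:E <= B%:E)%E.
  apply: integral_convex_bound => //.
  - apply: (measurableT_comp (measurable_powR _)).
    exact: measurableT_comp.
  - move=> t t01; have [_ /(_ a (b / m) t)] := f2_convex.
    (* the choice of the points [a] and [b / m] puts the argument on [[a, b]] *)
    have -> : t * a + m * (1 - t) * (b / m) = l t by rewrite /l; field.
    apply=> //; [|by right].
    by left; rewrite /= in_itv/= lexx ltW.
have wB := weighted_integral_le_Beta hp hq my yB.
(* closed formulas for the derivatives of [k], valid on [[0, 1]]: iterating
   [derive1] would require a formula for [derive1 k] on a neighbourhood *)
pose k := f \o l.
pose k1 : R -> R := fun t => f1 (l t) * (a - b).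
pose k2 : R -> R := fun t => f2 (l t) * (a - b) ^+ 2.
have dk : {in `[0, 1], forall t : R, is_derive t 1 k (k1 t)}.
  by move=> t /lab /abI /df dft; exact: is_derive1_comp.
have dk1 : {in `[0, 1], forall t : R, is_derive t 1 k1 (k2 t)}.
  move=> t /lab /abI /df1 dft.
  have -> : k1 = (a - b) *: (f1 \o l).
    by apply/funext => s; rewrite /k1 mulrC.
  have df1l : is_derive t 1 (f1 \o l) (f2 (l t) * (a - b)) by exact: is_derive1_comp.
  apply: is_derive_eq.
  by transitivity ((a - b) * (f2 (l t) * (a - b))); [|rewrite /k2; ring].
have mk2 : measurable_fun `[0 : R, 1] k2 by apply: measurable_funM.
have := trapezoid_error_le ltr01 dk dk1 mk2.
have -> : (b - a) ^+ 2 / 2 * Beta (p + 1) (p + 1) `^ p^-1 * B `^ q^-1 =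
    (b - a) ^+ 2 / 2 * (Beta (p + 1) (p + 1) `^ p^-1 * B `^ q^-1) by rewrite mulrA.
rewrite (Rintegral_segment_param hab cf) mulKf ?gt_eqF//.
have -> : (1 - 0) * ((k 0 + k 1) / 2) = (f a + f b) / 2.
  have k0 : k 0 = f b by rewrite /k /=; congr f; rewrite /l; ring.
  have k1' : k 1 = f a by rewrite /k /=; congr f; rewrite /l; ring.
  by rewrite k0 k1' subr0 mul1r addrC.
rewrite -lee_fin => /le_trans; apply.
have -> :
    (\int[mu]_(t in `[0%R, 1%R]) ((t - 0) * (1 - t) / 2 * `|k2 t|)%:E =
    ((b - a) ^+ 2 / 2)%:E *
    \int[mu]_(t in `[0%R, 1%R]) (t * (1 - t) * `|(f2 \o l) t|)%:E)%E.
  rewrite -ge0_integralZl//; first last.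
  - by rewrite lee_fin divr_ge0// exprn_ge0// ltW.
  - move=> t; rewrite /= in_itv/= => /andP[t0 t1].
    by rewrite lee_fin !mulr_ge0// subr_ge0.
  - apply/measurable_EFinP; apply: measurable_funM; last exact: measurableT_comp.
    by apply: measurable_funM => //; exact: measurable_funB.
  apply: eq_integral => t _; rewrite -EFinM /k2 normrM normrX distrC subr0.
  by rewrite (gtr0_norm ba0) /=; congr (_ %:E); field.
rewrite [leRHS]EFinM; apply: lee_wpmul2l => //.
by rewrite lee_fin divr_ge0// exprn_ge0// ltW.
Qed.
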